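(* Let $\Gamma$ be an $m$-vertex graph that is thick. Then $\vert E(\Gamma)\vert \geq 2m-4$.
   Context: Graphs are finite and simple. $S^{(2)}$ is the set of $2$-element subsets of $S$; $\Gamma[S]$ is the induced subgraph; $N_\Gamma(u)$ is the set of neighbours of $u$; $E(\overline\Gamma)$ is the set of non-edges of $\Gamma$ (as $2$-sets of vertices). The join $\Gamma_1*\Gamma_2$ is the disjoint union of $\Gamma_1$ and $\Gamma_2$ together with all edges between $V(\Gamma_1)$ and $V(\Gamma_2)$. A graph $\Gamma$ is thick of order $0$ if there is a partition $V(\Gamma)=A\sqcup B$ with neither $\Gamma[A]$ nor $\Gamma[B]$ a clique and $\Gamma=\Gamma[A]*\Gamma[B]$. A set $S\subseteq V(\Gamma)$ is thick of order $0$ if $\Gamma[S]$ is. $T_0(\Gamma)$ is the collection of inclusion-maximal thick of order $0$ subsets $S$; the associated sets of non-edges $S^{(2)}\cap E(\overline\Gamma)$ are the level $0$ components of $\Gamma$. $T_1(\Gamma)$ is the graph with vertex set $E(\overline\Gamma)$ in which $f,f'$ are adjacent if $f\cup f'$ induces a $4$-cycle $C_4$ in $\Gamma$. For $f=\{u_1,u_2\}\in E(\overline\Gamma)$ let $\mathrm{susp}(f)=N_\Gamma(u_1)\cap N_\Gamma(u_2)$. For $k\geq1$ and a connected component $C$ of $T_k(\Gamma)$ let $\mathrm{supp}_k(C)=\bigcup_{f\in C}(f\cup\mathrm{susp}(f))$ and $\mathrm{latch}_k(C)=E(\overline\Gamma)\cap(\mathrm{supp}_k(C))^{(2)}$. $T_{k+1}(\Gamma)$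 is the graph with vertex set $E(\overline\Gamma)$ in which $f_1,f_2$ are adjacent if there exist (possibly equal) connected components $C_1,C_2$ of $T_k(\Gamma)$ with $f_i\in\mathrm{latch}_k(C_i)$ for $i=1,2$ and $\mathrm{latch}_k(C_1)\cap\mathrm{latch}_k(C_2)\neq\emptyset$. A set $C\subseteq E(\overline\Gamma)$ that is a connected component of some $T_k(\Gamma)$, $k\geq1$, and is not a subset of a level $0$ component is a level $k_0$ component, where $k_0\geq 1$ is the least integer $k\ge 1$ such that $C$ is a connected component of $T_k(\Gamma)$; it has full support if $\mathrm{supp}_{k_0}(C)=V(\Gamma)$. If a level $k_0$ component of full support exists, $\Gamma$ is thick of order $k_0$. $\Gamma$ is thick if it is thick of some finite order $k\geq0$. *)

(* Defs.v *)
From HB Require Import structures.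
From mathcomp Require Import all_boot.

Set Implicit Arguments.
Unset Strict Implicit.
Unset Printing Implicit Defensive.

(* A finite simple graph is a finType V of vertices with a symmetric and
   irreflexive adjacency relation e; edges and non-edges are 2-sets. *)
Section Thickness.

Variables (V : finType) (e : rel V).

Definition edges : {set {set V}} :=
  [set s | [exists x, exists y, e x y && (s == [set x; y])]].

Definition nonedges : {set {set V}} :=
  [set s | [exists x, exists y, [&& x != y, ~~ e x y & s == [set x; y]]]].

(* S^(2) :&: nonedges, where S^(2) is the set of pairs of elements of S *)
Definition nonedges_in (S : {set V}) : {set {set V}} :=
  nonedges ::&: S.

Definition neighbours (u : V) : {set V} := [set w | e u w].

Definition clique (S : {set V}) : bool :=
  [forall x in S, forall y in S, (x != y) ==> e x y].

(* Gamma[S] = Gamma[A] * Gamma[B] with S the disjoint union of A and B: inside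
   A and inside B both sides have the edges of Gamma, so the equation amounts
   to the presence of all the edges between A and B. *)
Definition is_join (S A B : {set V}) : bool :=
  [&& S == A :|: B, [disjoint A & B] & [forall x in A, forall y in B, e x y]].

Definition thick0_set (S : {set V}) : bool :=
  [exists A : {set V}, exists B : {set V},
    [&& is_join S A B, ~~ clique A & ~~ clique B]].

Definition level0_component (D : {set {set V}}) : Prop :=
  exists S : {set V}, maxset thick0_set S /\ D = nonedges_in S.

Definition induces_C4 (S : {set V}) : bool :=
  [exists a, exists b, exists c, exists d,
    [&& uniq [:: a; b; c; d], S == [set a; b; c; d],
        [&& e a b, e b c, e c d & e d a], ~~ e a c & ~~ e b d]].

Definition square_adj : rel {set V} := fun f f' =>
  [&& f \in nonedges, f' \in nonedges & induces_C4 (f :|: f')].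

(* The connected components, as sets of vertices, of the graph with vertex set
   nonedges and adjacency relation adj (which only relates non-edges). *)
Definition components (adj : rel {set V}) : {set {set {set V}}} :=
  [set [set f' in nonedges | connect adj f f'] | f in nonedges].

Definition susp (f : {set V}) : {set V} := \bigcap_(u in f) neighbours u.

(* The dependence on the level k is only through the set C. *)
Definition supp (C : {set {set V}}) : {set V} :=
  \bigcup_(f in C) (f :|: susp f).

Definition latch (C : {set {set V}}) : {set {set V}} := nonedges_in (supp C).

Definition latch_adj (adj : rel {set V}) : rel {set V} := fun f1 f2 =>
  (f1 != f2) &&
  [exists C1 in components adj, exists C2 in components adj,
    [&& f1 \in latch C1, f2 \in latch C2 & latch C1 :&: latch C2 != set0]].

(* T k is the adjacency relation of T_k for k >= 1; the value at 0 is a dummy,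
   and every use below has 0 < k. *)
Fixpoint T (k : nat) : rel {set V} :=
  match k with
  | 0 => fun _ _ => false
  | 1 => square_adj
  | k'.+1 => latch_adj (T k')
  end.

Definition level_component (k : nat) (C : {set {set V}}) : Prop :=
  [/\ 0 < k,
      C \in components (T k),
      forall j, 0 < j -> j < k -> C \notin components (T j)
    & ~ exists D, level0_component D /\ C \subset D].

Definition thick_of_order (k : nat) : Prop :=
  if k is 0 then thick0_set [set: V]
  else exists C, level_component k C /\ supp C = [set: V].

Definition thick : Prop := exists k, thick_of_order k.

End Thickness.

(* Main.v *)
Require Import Defs.
From HB Require Import structures.
From mathcomp Require Import all_boot.
From mathcomp Require Import zify.

Set Implicit Arguments.
Unset Strict Implicit.
Unset Printing Implicit Defensive.

(** For a set S of vertices write E(S) for the number of edges inside S and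
    phi(S) = 2|S| - 4 - E(S).  The claim is phi(V) <= 0.  A non-edge f has
    phi(f) = 0, and adding to a set a vertex with two neighbours in it does not
    increase phi; so phi(f u susp f) <= 0.  Thick graphs are assembled from
    these pieces by gluing sets that share a non-edge.

    The inequality phi <= 0 alone does not survive such a gluing: the two sets
    may overlap in more than the shared non-edge, and the edges of a dense
    overlap would be counted twice.  The property that does survive, called
    [rel_dense] below, is a relative one: phi(T) >= phi(S) for every subset T
    of S that has at least three vertices or is a non-edge.  The other subsets
    (at most one vertex, or the two ends of an edge) have negative phi and must
    be excluded.

    Gluing ([rel_denseU]).  Let S1 and S2 have the property and share a
    non-edge g, and let T be an admissible subset of their union.  As phi is
    submodular, adding S1 to T does not increase phi if T n S1 is admissible;
    adding S2 then does not increase it either, since T u S1 and S2 share g.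
    The only remaining case is that neither T n S1 nor T n S2 is admissible.
    Both then have at most two vertices, so that, up to the edges that run
    between S1 \ S2 and S2 \ S1, phi(T) >= 0; these edges occur in S1 u S2 as
    well, and without them phi(S1 u S2) <= 0.

    Every f u susp f is glued from paths u1 x u2 with f = {u1, u2}
    ([rel_dense_suspension]).  Adjacency in T_1 or in T_(k+1) provides a set
    with the property that contains both non-edges and stays in the support,
    so supports of components have the property at every level
    ([rel_dense_supp], [rel_dense_supp_T]).  A thick graph is such a support,
    or, at order 0, the union of two suspensions; comparing V with a single
    non-edge gives phi(V) <= 0. *)

Section EdgeCount.

Variables (V : finType) (e : rel V).
Hypotheses (esym : symmetric e) (eirr : irreflexive e).

Implicit Types (A S T f g h : {set V}) (x y u v : V) (C : {set {set V}}).

(** * Edges and non-edges *)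

Lemma in_edges2 x y : e x y -> [set x; y] \in edges e.
Proof.
by move=> exy; rewrite inE; apply/existsP; exists x; apply/existsP; exists y;
  rewrite exy /=.
Qed.

Lemma edgesP s :
  reflect (exists x y, e x y /\ s = [set x; y]) (s \in edges e).
Proof.
rewrite inE; apply: (iffP existsP) => [[x /existsP[y /andP[exy /eqP ->]]]|].
  by exists x, y.
by move=> [x [y [exy ->]]]; exists x; apply/existsP; exists y; rewrite exy /=.
Qed.

Lemma nonedgesP s :
  reflect (exists x y, [/\ x != y, ~~ e x y & s = [set x; y]])
          (s \in nonedges e).
Proof.
rewrite inE; apply: (iffP existsP)
  => [[x /existsP[y /and3P[xy exy /eqP ->]]]|].
  by exists x, y.
move=> [x [y [xy exy ->]]]; exists x; apply/existsP; exists y.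
by rewrite xy exy /=.
Qed.

Lemma card_edge s : s \in edges e -> #|s| = 2.
Proof.
move=> /edgesP[x [y [exy ->]]]; rewrite cards2.
by case: eqP exy => // ->; rewrite eirr.
Qed.

Lemma card_nonedge s : s \in nonedges e -> #|s| = 2.
Proof. by move=> /nonedgesP[x [y [xy _ ->]]]; rewrite cards2 xy. Qed.

Lemma edge_notin_nonedges s : s \in edges e -> s \notin nonedges e.
Proof.
move=> /edgesP[x [y [exy ->]]]; apply/nonedgesP => -[u [v [uv euv E]]].
have: u \in [set x; y] by rewrite E !inE eqxx.
have: v \in [set x; y] by rewrite E !inE eqxx orbT.
rewrite !inE => /orP[]/eqP vE /orP[]/eqP uE; move: uv euv; subst u v.
- by rewrite eqxx.
- by rewrite esym exy.
- by rewrite exy.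
- by rewrite eqxx.
Qed.

(** * Counting the edges inside a set *)

Definition edges_in S : {set {set V}} := edges e ::&: S.

Lemma mem_edges_in s S : (s \in edges_in S) = (s \in edges e) && (s \subset S).
Proof. by rewrite inE. Qed.

Lemma edges_in_setT : edges_in [set: V] = edges e.
Proof. by apply/setP => s; rewrite mem_edges_in subsetT andbT. Qed.

Lemma edges_inI S T : edges_in (S :&: T) = edges_in S :&: edges_in T.
Proof.
by apply/setP => s; rewrite [in RHS]inE !mem_edges_in subsetI; case: (s \in edges e).
Qed.

Lemma edges_inS S T : S \subset T -> edges_in S \subset edges_in T.
Proof.
move=> ST; apply/subsetP => s; rewrite !mem_edges_in => /andP[-> sS].
exact: subset_trans sS ST.
Qed.

(** An edge inside S or inside T is inside their union; it is counted twice
    exactly when it is inside the intersection. *)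
Lemma card_edges_in_supermodular S T :
  #|edges_in S| + #|edges_in T| <= #|edges_in (S :|: T)| + #|edges_in (S :&: T)|.
Proof.
rewrite -cardsUI edges_inI leq_add2r subset_leq_card // subUset.
by rewrite !edges_inS ?subsetUl ?subsetUr.
Qed.

(** For T inside S1 u S2 these are the edges of T between S1 \ S2 and S2 \ S1. *)
Definition cross_edges S1 S2 T :=
  edges_in T :\: (edges_in S1 :|: edges_in S2).

Lemma card_edges_in_cross S1 S2 T :
  #|edges_in T| + #|edges_in (T :&: (S1 :&: S2))|
  = #|edges_in (T :&: S1)| + #|edges_in (T :&: S2)| + #|cross_edges S1 S2 T|.
Proof.
rewrite -(cardsID (edges_in S1 :|: edges_in S2) (edges_in T)) -/(cross_edges _ _ _).
have -> : edges_in T :&: (edges_in S1 :|: edges_in S2)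
    = edges_in (T :&: S1) :|: edges_in (T :&: S2).
  by rewrite setIUr !edges_inI.
have -> : edges_in (T :&: (S1 :&: S2))
    = edges_in (T :&: S1) :&: edges_in (T :&: S2).
  by rewrite -edges_inI setIACA setIid.
by rewrite addnAC cardsUI.
Qed.

Lemma card_edges_in_small S : #|S| <= 2 -> #|edges_in S| <= #|S|.-1.
Proof.
move=> S2.
have: edges_in S \subset [set s | (s == S) && (#|S| == 2)].
  apply/subsetP => s; rewrite mem_edges_in => /andP[/card_edge s2 sS]; rewrite inE.
  have S2' : #|S| = 2.
    by apply/eqP; rewrite eqn_leq S2 -s2 subset_leq_card.
  by rewrite S2' andbT eqEcard sS S2' s2.
move=> /subset_leq_card/leq_trans; apply.
case: (#|S| =P 2) => [->|_].
  by rewrite (_ : [set s | _] = [set S]) ?cards1 //;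
    apply/setP => s; rewrite !inE andbT.
by rewrite (_ : [set s | _] = set0) ?cards0 //;
    apply/setP => s; rewrite !inE andbF.
Qed.

Lemma edges_in_nonedge f : f \in nonedges e -> edges_in f = set0.
Proof.
move=> fN; apply/setP => s; rewrite mem_edges_in in_set0; apply/negP => /andP[sE sf].
have/eqP sfE: s == f by rewrite eqEcard sf (card_edge sE) (card_nonedge fN).
by move: (edge_notin_nonedges sE); rewrite sfE fN.
Qed.

(** * Relative density and gluing *)

(** The subsets that can be compared with a suspension.  The two ends of an edge
    do not qualify: the path u1 x u2 has a vertex more than its subset {u1, x},
    but only one edge more. *)
Definition nondegenerate T := (2 < #|T|) || (T \in nonedges e).

Lemma nondegenerateS S T : S \subset T -> nondegenerate S -> nondegenerate T.
Proof.
move=> ST /orP[S3|SN]; rewrite /nondegenerate.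
  by rewrite (leq_trans S3) // subset_leq_card.
case: (ltnP 2 #|T|) => //= T2.
suff /eqP <- : S == T by [].
by rewrite eqEcard ST (card_nonedge SN).
Qed.

Lemma nondegenerate_nonedge f S :
  f \in nonedges e -> f \subset S -> nondegenerate S.
Proof. by move=> fN /nondegenerateS; apply; rewrite /nondegenerate fN orbT. Qed.

(** With phi(S) = 2|S| - 4 - E(S) the inequality reads phi(S) <= phi(T); the
    terms are arranged so that no subtraction occurs. *)
Definition rel_dense S :=
  forall T, T \subset S -> nondegenerate T ->
    2 * #|S| + #|edges_in T| <= 2 * #|T| + #|edges_in S|.

(** Submodularity of phi turns the property, which speaks of subsets of S, into
    one on sets that merely meet S in a nondegenerate set. *)
Lemma rel_dense_absorb S T : rel_dense S -> nondegenerate (T :&: S) ->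
  2 * #|T :|: S| + #|edges_in T| <= 2 * #|T| + #|edges_in (T :|: S)|.
Proof.
move=> dS ndTS; have := dS _ (subsetIr T S) ndTS.
have := card_edges_in_supermodular T S; have := cardsUI T S.
lia.
Qed.

(** The gluing step.  Degenerate traces of T on S1 and S2 are harmless because
    they have at most two vertices, and a set of one or two vertices spans
    fewer edges than it has vertices. *)
Lemma rel_denseU S1 S2 g : rel_dense S1 -> rel_dense S2 ->
  g \in nonedges e -> g \subset S1 -> g \subset S2 -> rel_dense (S1 :|: S2).
Proof.
move=> + + gN; move: S1 S2.
(* T absorbs S1 through their nondegenerate overlap, then S2 through g. *)
have overlap S1 S2 T : rel_dense S1 -> rel_dense S2 ->
    g \subset S1 -> g \subset S2 -> T \subset S1 :|: S2 ->
    nondegenerate (T :&: S1) ->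
    2 * #|S1 :|: S2| + #|edges_in T| <= 2 * #|T| + #|edges_in (S1 :|: S2)|.
  move=> d1 d2 g1 g2 TS nd1.
  have nd2 : nondegenerate ((T :|: S1) :&: S2).
    by apply: nondegenerate_nonedge gN _; rewrite subsetI subsetU ?g1 ?orbT.
  have := rel_dense_absorb d1 nd1; have := rel_dense_absorb d2 nd2.
  by rewrite -setUA (setUidPr TS); lia.
move=> S1 S2 d1 d2 g1 g2 T TS ndT.
have [nd1|deg1] := boolP (nondegenerate (T :&: S1)); first exact: overlap nd1.
have [nd2|deg2] := boolP (nondegenerate (T :&: S2)).
  by rewrite setUC; apply: overlap nd2; rewrite // setUC.
have small A : ~~ nondegenerate A -> #|A| <= 2.
  by rewrite negb_or -leqNgt => /andP[].
have TE : (T :&: S1) :|: (T :&: S2) = T by rewrite -setIUr; apply/setIidPl.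
have T0E : (T :&: S1) :&: (T :&: S2) = T :&: (S1 :&: S2).
  by rewrite setIACA setIid.
(* Neither trace contains the other: T would then equal one of them, and be
   degenerate. *)
have lt1 : #|T :&: (S1 :&: S2)| < #|T :&: S1|.
  rewrite -T0E ltnNge; apply: contra deg2 => le.
  have /setUidPr T12 : T :&: S1 \subset T :&: S2.
    by apply/setIidPl/eqP; rewrite eqEcard subsetIl.
  by rewrite -T12 TE.
have lt2 : #|T :&: (S1 :&: S2)| < #|T :&: S2|.
  rewrite -T0E ltnNge; apply: contra deg1 => le.
  have /setUidPl T21 : T :&: S2 \subset T :&: S1.
    by apply/setIidPr/eqP; rewrite eqEcard subsetIr.
  by rewrite -T21 TE.
have le1 := card_edges_in_small (small _ deg1).
have le2 := card_edges_in_small (small _ deg2).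
have cT := cardsUI (T :&: S1) (T :&: S2); rewrite TE T0E in cT.
have xT := card_edges_in_cross S1 S2 T.
have cS := cardsUI S1 S2.
have xS := card_edges_in_cross S1 S2 (S1 :|: S2).
(* Nothing bounds the number of cross edges, but those of T are among those of
   the union and cancel in the comparison. *)
have xTS : #|cross_edges S1 S2 T| <= #|cross_edges S1 S2 (S1 :|: S2)|.
  by rewrite subset_leq_card // setSD // edges_inS.
rewrite setIA setUK (setUC S1 S2) setUK (setUC S2 S1) in xS.
have gS0 : g \subset S1 :&: S2 by rewrite subsetI g1.
(* Without its cross edges the union has at least 2|S1 u S2| - 4 edges: S2 has
   2|S2| - 4 by comparison with g, and passing from the overlap to S1 adds two
   edges per vertex. *)
have dS1 := d1 _ (subsetIl S1 S2) (nondegenerate_nonedge gN gS0).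
have dS2 := d2 _ g2 (nondegenerate_nonedge gN (subxx g)).
rewrite (edges_in_nonedge gN) cards0 (card_nonedge gN) in dS2.
lia.
Qed.

(** * Suspensions *)

Lemma rel_dense_nonedge f : f \in nonedges e -> rel_dense f.
Proof.
move=> fN T Tf /orP[T3|TN].
  by have := subset_leq_card Tf; rewrite (card_nonedge fN); lia.
suff /eqP -> : T == f by [].
by rewrite eqEcard Tf (card_nonedge TN) (card_nonedge fN).
Qed.

Lemma suspP f x : reflect (forall u, u \in f -> e u x) (x \in susp e f).
Proof.
by apply: (iffP bigcapP) => H u uf; have := H u uf; rewrite inE.
Qed.

(** The only nondegenerate subsets of a path of length two are the path and its
    two ends. *)
Lemma rel_dense_cherry f x :
  f \in nonedges e -> x \in susp e f -> rel_dense (f :|: [set x]).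
Proof.
move=> fN /suspP xf T TS ndT.
have /nonedgesP[u [v [uv euv fE]]] := fN.
have eu : e u x by apply: xf; rewrite fE !inE eqxx.
have ev : e v x by apply: xf; rewrite fE !inE eqxx orbT.
have cS : #|f :|: [set x]| <= 3.
  by have := cardsUI f [set x]; rewrite cards1 (card_nonedge fN); lia.
case/orP: ndT => [T3|TN].
  suff /eqP -> : T == f :|: [set x] by [].
  by rewrite eqEcard TS (leq_trans cS).
rewrite (edges_in_nonedge TN) cards0 (card_nonedge TN).
suff : 2 <= #|edges_in (f :|: [set x])| by lia.
have ne : [set u; x] != [set v; x].
  apply/eqP => /setP/(_ u); rewrite !inE eqxx (negPf uv) /=.
  by case: eqP eu => // ->; rewrite eirr.
suff: [set [set u; x]; [set v; x]] \subset edges_in (f :|: [set x]).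
  by move/subset_leq_card; rewrite cards2 ne.
rewrite subUset !sub1set !mem_edges_in !in_edges2 //= fE !subUset !sub1set.
by rewrite !inE !eqxx !orbT.
Qed.

(** The paths through the vertices of susp f all share the non-edge f. *)
Lemma rel_dense_suspension f : f \in nonedges e -> rel_dense (f :|: susp e f).
Proof.
move=> fN.
suff H (s : seq V) : {subset s <= susp e f} -> rel_dense (f :|: [set x in s]).
  have := H (enum (susp e f)); rewrite set_enum; apply=> x.
  by rewrite mem_enum.
elim: s => [_|x s IH xs].
  by rewrite set_nil setU0; apply: rel_dense_nonedge.
have -> : f :|: [set y in x :: s] = (f :|: [set x]) :|: (f :|: [set y in s]).
  by rewrite set_cons setUUr.
apply: rel_denseU (fN) (subsetUl _ _) (subsetUl _ _).
  by apply: rel_dense_cherry fN _; apply: xs; rewrite mem_head.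
by apply: IH => y ys; apply: xs; rewrite inE ys orbT.
Qed.

(** * Components and their supports *)

Lemma suspension_sub_supp f C : f \in C -> f :|: susp e f \subset supp e C.
Proof. by move=> fC; apply: (bigcup_max f). Qed.

Lemma latchP f C :
  reflect (f \in nonedges e /\ f \subset supp e C) (f \in latch e C).
Proof. by rewrite [f \in latch e C]in_set; apply: andP. Qed.

Lemma nonedge_in_latch f C : f \in nonedges e -> f \in C -> f \in latch e C.
Proof.
move=> fN fC; apply/latchP; split=> //.
exact: subset_trans (subsetUl _ _) (suspension_sub_supp fC).
Qed.

Lemma component_sub_nonedges adj C :
  C \in components e adj -> C \subset nonedges e.
Proof. by move=> /imsetP[f _ ->]; apply/subsetP => h; rewrite inE => /andP[]. Qed.

Lemma component_closed adj C h h' : C \in components e adj ->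
  h \in C -> adj h h' -> h' \in nonedges e -> h' \in C.
Proof.
move=> /imsetP[f _ ->]; rewrite !inE => /andP[_ fh] hh' ->.
exact: connect_trans fh (connect1 hh').
Qed.

(** Following paths of the component from one of its members f, all the linking
    sets and the suspensions of the members are glued on; every partial union
    contains f and stays in the support, so that any two of them can be glued
    along f, and together they exhaust the support. *)
Lemma rel_dense_supp adj C : C \in components e adj ->
  (forall h h', adj h h' -> h' \in nonedges e) ->
  (forall h h', h \in C -> adj h h' -> exists U, [/\ rel_dense U, h \subset U,
      h' \subset U & U \subset supp e C]) ->
  rel_dense (supp e C).
Proof.
move=> Cc adjN link.
have CN := subsetP (component_sub_nonedges Cc).
have /imsetP[f fN CE] := Cc.
have fC : f \in C by rewrite CE inE fN connect0.
pose good (A : {set V}) := [/\ rel_dense A, f \subset A & A \subset supp e C].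
have good_extend A U h : good A -> rel_dense U -> h \in C -> h \subset A ->
    h \subset U -> U \subset supp e C -> good (A :|: U).
  move=> [dA fA AC] dU hC hA hU UC; split.
  - exact: rel_denseU dA dU (CN _ hC) hA hU.
  - exact: subset_trans fA (subsetUl _ _).
  - by rewrite subUset AC.
have reach h : h \in C -> exists2 A, good A & h \subset A.
  rewrite {1}CE inE => /andP[_ /connectP[p pp ->]].
  suff [_ ] : last f p \in C /\ exists2 A, good A & last f p \subset A by [].
  elim/last_ind: p pp => [_|p h' IH].
    split=> //; exists f => //; split=> //; first exact: rel_dense_nonedge.
    exact: subset_trans (subsetUl _ _) (suspension_sub_supp fC).
  rewrite rcons_path last_rcons => /andP[/IH[lC [A gA lA]] adj_h'].
  split; first exact: component_closed Cc lC adj_h' (adjN _ _ adj_h').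
  have [U [dU lU h'U UC]] := link _ _ lC adj_h'.
  exists (A :|: U); first exact: good_extend lA lU UC.
  exact: subset_trans h'U (subsetUr _ _).
have cover (s : seq {set V}) : {subset s <= C} ->
    exists2 A, good A & {in s, forall h, h :|: susp e h \subset A}.
  elim: s => [_|h s IH sC]; first by have [A gA _] := reach f fC; exists A.
  have hC : h \in C by apply: sC; rewrite mem_head.
  have [|A gA sA] := IH; first by move=> u us; apply: sC; rewrite inE us orbT.
  have [B gB hB] := reach h hC.
  have [dD fD DC] : good (B :|: (h :|: susp e h)).
    apply: good_extend gB (rel_dense_suspension (CN _ hC)) (hC) hB _ _.
      exact: subsetUl.
    exact: suspension_sub_supp.
  have [dA fA AC] := gA.
  exists (A :|: (B :|: (h :|: susp e h))).
    exact: good_extend gA dD fC fA fD DC.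
  move=> u; rewrite inE => /orP[/eqP->|us].
    by rewrite [B :|: _]setUC setUCA subsetUl.
  exact: subset_trans (sA _ us) (subsetUl _ _).
have [|A [dA _ AC] CA] := cover (enum C); first by move=> h; rewrite mem_enum.
suff -> : supp e C = A by [].
apply/eqP; rewrite eqEsubset AC andbT; apply/bigcupsP => h hC.
by apply: CA; rewrite mem_enum.
Qed.

(** The only non-edges inside an induced square are its two diagonals, so that h
    and h' are opposite diagonals. *)
Lemma square_opposite h h' : square_adj e h h' -> h' \subset susp e h.
Proof.
move=> /and3P[hN h'N].
case/existsP=> a /existsP[b /existsP[c /existsP[d]]].
case/and5P=> abcd /eqP hh' /and4P[ab bc cd da] nac nbd.
have diag f : f \in nonedges e -> f \subset h :|: h' ->
    f = [set a; c] \/ f = [set b; d].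
  move=> /nonedgesP[x [y [xy exy ->]]]; rewrite hh' subUset !sub1set !inE.
  have {}exy z t : e z t -> x = z -> y = t -> False.
    by move=> ezt xz yt; move: exy; rewrite xz yt ezt.
  have ba := ab; have cb := bc; have dc := cd; have ad := da.
  rewrite esym in ba; rewrite esym in cb; rewrite esym in dc; rewrite esym in ad.
  rewrite -!orbA => /andP[/or4P[]/eqP xE /or4P[]/eqP yE];
    try (by case: (exy _ _ _ xE yE));
    try (by move: xy; rewrite xE yE eqxx);
    subst x y; by [left; rewrite ?[[set c; a]]setUC | right; rewrite ?[[set d; b]]setUC].
have aS : a \in h :|: h' by rewrite hh' !inE eqxx.
have bS : b \in h :|: h' by rewrite hh' !inE eqxx !orbT.
have [nab nbc ncd nda] : [/\ a != b, b != c, c != d & d != a].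
  by split; apply/eqP => E; move: ab bc cd da; rewrite E eirr.
have [hE|hE] := diag h hN (subsetUl _ _);
have [h'E|h'E] := diag h' h'N (subsetUr _ _).
- by move: bS; rewrite hE h'E setUid !inE eq_sym (negPf nab) (negPf nbc).
- apply/subsetP => z; rewrite h'E => zbd; apply/suspP => w; rewrite hE.
  by move: zbd; rewrite !inE => /orP[]/eqP-> /orP[]/eqP->; rewrite // esym.
- apply/subsetP => z; rewrite h'E => zbd; apply/suspP => w; rewrite hE.
  by move: zbd; rewrite !inE => /orP[]/eqP-> /orP[]/eqP->; rewrite // esym.
- by move: aS; rewrite hE h'E setUid !inE (negPf nab) eq_sym (negPf nda).
Qed.

(** In T_1 the suspension of h links h to its neighbours.  In T_(k+1) the link is
    the union of the supports of the two components of T_k that witness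
    adjacency, glued along the non-edge common to their latches.  These supports
    stay in the support of C: every member of the two components lies in the
    latch of its component, hence is equal or adjacent to h in T_(k+1). *)
Lemma rel_dense_supp_T k C :
  C \in components e (T e k.+1) -> rel_dense (supp e C).
Proof.
elim: k C => [|k IH] C Cc; apply: (rel_dense_supp Cc).
- by move=> h h' /and3P[].
- move=> h h' hC hh'; exists (h :|: susp e h).
  have hN := subsetP (component_sub_nonedges Cc) _ hC.
  split; [exact: rel_dense_suspension|exact: subsetUl| |exact: suspension_sub_supp].
  by rewrite subsetU // (square_opposite hh') orbT.
- by move=> h h' /andP[_] /exists_inP[C1 _] /exists_inP[C2 _] /and3P[_ /latchP[]].
move=> h h' hC /andP[_] /exists_inP[C1 C1c] /exists_inP[C2 C2c].
case/and3P=> hC1 h'C2 C12.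
have /set0Pn[g /setIP[/latchP[gN g1] /latchP[_ g2]]] := C12.
have /latchP[hN h1] := hC1; have /latchP[_ h2] := h'C2.
have sub_supp D : D \in components e (T e k.+1) ->
    latch e C1 :&: latch e D != set0 -> supp e D \subset supp e C.
  move=> Dc C1D; apply/bigcupsP => u uD; apply: suspension_sub_supp.
  have uN := subsetP (component_sub_nonedges Dc) _ uD.
  have [<-|hu] := eqVneq h u; first by [].
  apply: (component_closed Cc hC _ uN).
  rewrite /= /latch_adj hu; apply/exists_inP; exists C1 => //.
  apply/exists_inP; exists D => //.
  by rewrite hC1 C1D nonedge_in_latch.
exists (supp e C1 :|: supp e C2); split.
- exact: rel_denseU (IH _ C1c) (IH _ C2c) gN g1 g2.
- exact: subset_trans h1 (subsetUl _ _).
- exact: subset_trans h2 (subsetUr _ _).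
- rewrite subUset !sub_supp //.
  by apply/set0Pn; exists h; rewrite inE hC1.
Qed.

(** * Thick graphs *)

Lemma not_cliqueP S :
  ~~ clique e S -> exists2 f, f \in nonedges e & f \subset S.
Proof.
rewrite negb_forall_in => /exists_inP[x xS].
rewrite negb_forall_in => /exists_inP[y yS].
rewrite negb_imply => /andP[xy exy].
exists [set x; y]; last by rewrite subUset !sub1set xS yS.
by apply/nonedgesP; exists x, y.
Qed.

(** For a non-edge f in A and a non-edge g in B, the suspension of f contains B
    and that of g contains A; both contain g. *)
Lemma rel_dense_thick0 : thick0_set e [set: V] ->
  rel_dense [set: V] /\ exists f, f \in nonedges e.
Proof.
case/existsP=> A /existsP[B /and3P[/and3P[/eqP VE _ join]]].
move=> /not_cliqueP[f fN fA] /not_cliqueP[g gN gB].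
split; last by exists f.
have Bf : B \subset susp e f.
  apply/subsetP => y yB; apply/suspP => x xf.
  exact: (forall_inP (forall_inP join x (subsetP fA x xf)) y yB).
have Ag : A \subset susp e g.
  apply/subsetP => y yA; apply/suspP => x xg; rewrite esym.
  exact: (forall_inP (forall_inP join y yA) x (subsetP gB x xg)).
have <- : (f :|: susp e f) :|: (g :|: susp e g) = [set: V].
  apply/eqP; rewrite eqEsubset subsetT VE subUset.
  by rewrite subsetU ?[A \subset g :|: _]subsetU ?Ag ?orbT //= subsetU // subsetU // Bf orbT.
apply: (rel_denseU (rel_dense_suspension fN) (rel_dense_suspension gN) gN).
  by rewrite subsetU // (subset_trans gB Bf) orbT.
exact: subsetUl.
Qed.

Lemma rel_dense_thick : thick e ->
  rel_dense [set: V] /\ exists f, f \in nonedges e.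
Proof.
move=> [[|k]]; first exact: rel_dense_thick0.
move=> [C [[_ Cc _ _] <-]]; split; first exact: rel_dense_supp_T Cc.
by have /imsetP[f fN _] := Cc; exists f.
Qed.

End EdgeCount.

Theorem theorem1p4 (V : finType) (e : rel V) (m : nat)
    (esym : symmetric e) (eirr : irreflexive e)
    (hm : #|V| = m) (hthick : thick e) :
  2 * m - 4 <= #|edges e|.
Proof.
have [dV [f fN]] := rel_dense_thick esym eirr hthick.
have := dV f (subsetT f) (nondegenerate_nonedge fN (subxx f)).
rewrite edges_in_setT edges_in_nonedge // cards0 (card_nonedge fN) cardsT hm.
lia.
Qed.
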